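(* Let $G=(X,b)$ be a connected graph. Then $G$ is uniformly transient if and only if $\mathfrak{D}_0(G)$ is an algebra (with respect to pointwise addition and multiplication of functions).
   Context: A graph $G=(X,b)$ consists of a nonempty countable set $X$ (nodes) and a symmetric function $b:X\times X\to[0,\infty)$ with $b(x,x)=0$ for all $x$ and $\sum_{y\in X}b(x,y)<\infty$ for all $x\in X$. (Local finiteness is not assumed.) Two nodes $x,y$ are connected if there is a finite sequence $x=x_0,\ldots,x_n=y$ with $b(x_k,x_{k+1})>0$ for all $0\le k<n$; the graph is connected if all its nodes are connected to each other. The Dirichlet energy of $f:X\to\mathbb{C}$ is $\tilde{Q}(f)=\frac12\sum_{x,y\in X}b(x,y)|f(x)-f(y)|^2\in[0,\infty]$, and $\mathfrak{D}(G)=\{f:X\to\mathbb{C}\mid \tilde{Q}(f)<\infty\}$. Fix $o\in X$ and set $\|f\|_o^2=\tilde{Q}(f)+|f(o)|^2$ for $f\in\mathfrak{D}(G)$; for connected $G$, $(\mathfrak{D}(G),\|\cdot\|_o)$ is a Hilbert space on which all point evaluations are continuous. $C_c(X)$ denotes the set of functions $X\to\mathbb{C}$ with finite support, $\mathfrak{D}_0(G)$ the closure of $C_c(X)$ in $(\mathfrak{D}(G),\|\cdot\|_o)$ (this does not depend on the choice of $o$), and $C_0(X)$ the closure of $C_c(X)$ in $\ell^\infty(X)$ with respect to the supremum norm. The graph $G$ is uniformly transient if $\mathfrak{D}_0(G)\subseteq C_0(X)$. That $\mathfrak{D}_0(G)$ is an algebra means that it is closed under pointwise multiplication: $fg\in\mathfrak{D}_0(G)$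 for all $f,g\in\mathfrak{D}_0(G)$. *)

(* Defs.v *)
From HB Require Import structures.
From mathcomp Require Import all_boot all_order all_algebra.
From mathcomp Require Import all_classical all_reals all_analysis.
From mathcomp Require Import complex.

Set Implicit Arguments.
Unset Strict Implicit.
Unset Printing Implicit Defensive.

Import Order.TTheory GRing.Theory Num.Theory.

Local Open Scope classical_set_scope.
Local Open Scope ring_scope.
Local Open Scope complex_scope.

(* Modulus of a complex number as an element of [R]; the generic norm
   [`|z|] on [R[i]] takes its values in [R[i]]. *)
Definition cmod (R : realType) (z : R[i]) : R := ComplexField.Normc.normc z.

(* Weighted graph on the node set [X].  Nonemptiness of [X] is not part of the
   record: wherever it matters it is witnessed by a base point [o : X]. *)
Record graph (R : realType) (X : countType) := Graph {
  weight :> X -> X -> R;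
  weight_ge0 : forall x y, 0 <= weight x y;
  weight_sym : forall x y, weight x y = weight y x;
  weight_diag : forall x, weight x x = 0;
  weight_summable : forall x, (\esum_(y in [set: X]) (weight x y)%:E < +oo)%E
}.

(* [p] lists x_1, ..., x_n; the initial node x_0 = x is kept apart. *)
Definition connected_nodes (R : realType) (X : countType) (b : graph R X)
    (x y : X) : Prop :=
  exists p : seq X, path (fun u v => 0 < b u v) x p /\ last x p = y.

Definition connected_graph (R : realType) (X : countType) (b : graph R X) :
    Prop :=
  forall x y, connected_nodes b x y.

Definition energy (R : realType) (X : countType) (b : graph R X)
    (f : X -> R[i]) : \bar R :=
  ((2^-1 : R)%:E *
   \esum_(p in [set: X * X]) (b p.1 p.2 * cmod (f p.1 - f p.2) ^+ 2)%:E)%E.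

Definition finite_energy (R : realType) (X : countType) (b : graph R X) :
    set (X -> R[i]) :=
  [set f | (energy b f < +oo)%E].

(* Only meaningful on [finite_energy b], because of [fine]. *)
Definition norm_o (R : realType) (X : countType) (b : graph R X) (o : X)
    (f : X -> R[i]) : R :=
  Num.sqrt (fine (energy b f) + cmod (f o) ^+ 2).

Definition finite_support (R : realType) (X : countType) : set (X -> R[i]) :=
  [set f | finite_set [set x | f x != 0]].
Arguments finite_support : clear implicits.

Definition bounded_functions (R : realType) (X : countType) :
    set (X -> R[i]) :=
  [set f | exists M : R, forall x, cmod (f x) <= M].
Arguments bounded_functions : clear implicits.

(* Only meaningful on [bounded_functions R X] with [X] nonempty. *)
Definition sup_norm (R : realType) (X : countType) (f : X -> R[i]) : R :=
  sup [set cmod (f x) | x in [set: X]].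

(* Closure of [A] in the normed function space [(V, N)]; used only with
   [A `<=` V]. *)
Definition norm_closure (R : realType) (X : countType) (V : set (X -> R[i]))
    (N : (X -> R[i]) -> R) (A : set (X -> R[i])) : set (X -> R[i]) :=
  [set f | V f /\
     forall e : R, 0 < e -> exists g, A g /\ N (fun x => f x - g x) < e].

Definition D0 (R : realType) (X : countType) (b : graph R X) (o : X) :
    set (X -> R[i]) :=
  norm_closure (finite_energy b) (norm_o b o) (finite_support R X).

Definition C0 (R : realType) (X : countType) : set (X -> R[i]) :=
  norm_closure (bounded_functions R X) (@sup_norm R X) (finite_support R X).
Arguments C0 : clear implicits.

Definition uniformly_transient (R : realType) (X : countType) (b : graph R X)
    (o : X) : Prop :=
  D0 b o `<=` C0 R X.

(* The spaces this is applied to are linear subspaces, so that closure under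
   products is all there is to being an algebra. *)
Definition is_algebra (R : realType) (X : countType) (A : set (X -> R[i])) :
    Prop :=
  forall f g, A f -> A g -> A (fun x => f x * g x).

(* Main.v *)
(** Both properties are equivalent to a uniform bound |phi(x)|^2 <= C |phi|_o^2
    over all nodes x and all finitely supported phi.  Given such a bound, norm
    approximation by C_c is also uniform approximation, and fg is approximated
    by products of approximants of f and g because |hk|_o is controlled by
    |h|_o |k|_o.  Conversely, let K_x be the optimal constant at x and suppose
    that sup K_x is infinite.  Choose x_k with K_(x_k) growing fast, and phi_k
    in C_c almost extremal at x_k with |phi_k|_o <= 1.  Then
    F = sum_k 4^-k |phi_k| lies in D_0 and F(x_k)^2 >= 16^-k K_(x_k) / 2, so F
    is unbounded and D_0 is not contained in C_0; and F^2 is not in D_0 since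
    F(x_k)^4 <= 4 K_(x_k) |F^2|_o^2 would force
    256^-k K_(x_k) <= 16 |F^2|_o^2 for all k. *)

Require Import Defs.
From mathcomp Require Import all_boot all_order all_algebra.
From mathcomp Require Import all_classical all_reals all_analysis.
From mathcomp Require Import complex finmap ring lra.

Set Implicit Arguments.
Unset Strict Implicit.
Unset Printing Implicit Defensive.

Import Order.TTheory GRing.Theory Num.Theory.
Import numFieldNormedType.Exports.

Local Open Scope classical_set_scope.
Local Open Scope ring_scope.

(** * Squared inequalities for the complex modulus *)

Section Modulus.
Context {R : realType}.
Implicit Types z w : R[i].

Lemma cmod_sqr z : cmod z ^+ 2 = complex.Re z ^+ 2 + complex.Im z ^+ 2.
Proof. by case: z => a c; rewrite sqr_sqrtr //= addr_ge0 ?sqr_ge0. Qed.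

Lemma cmod_ge0 z : 0 <= cmod z.
Proof. by case: z => a c; rewrite sqrtr_ge0. Qed.

Lemma cmodM z w : cmod (z * w) = cmod z * cmod w.
Proof. exact: ComplexField.Normc.normcM. Qed.

Lemma cmod_real (a : R) : cmod a%:C%C = `|a|.
Proof. by rewrite /cmod /= expr0n /= addr0 sqrtr_sqr. Qed.

Lemma cmod_sqrD z w : cmod (z + w) ^+ 2 <= 2 * cmod z ^+ 2 + 2 * cmod w ^+ 2.
Proof.
rewrite !cmod_sqr; case: z w => a c [a' c'] /=.
by have := sqr_ge0 (a - a'); have := sqr_ge0 (c - c'); nra.
Qed.

Lemma cmodN z : cmod (- z) = cmod z.
Proof. by case: z => a c; rewrite /cmod /= !sqrrN. Qed.

Lemma cmod0 : cmod (0 : R[i]) = 0.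
Proof. exact: ComplexField.Normc.normc0. Qed.

(** The reverse triangle inequality, squared, amounts to Cauchy-Schwarz for [z] and [w] as plane
    vectors; the defect there is [(a * c' - c * a') ^+ 2]. *)
Lemma cmod_dist z w : (cmod z - cmod w) ^+ 2 <= cmod (z - w) ^+ 2.
Proof.
have h : complex.Re z * complex.Re w + complex.Im z * complex.Im w
    <= cmod z * cmod w.
  have := cmod_sqr z; have := cmod_sqr w; have := cmod_ge0 z.
  have := cmod_ge0 w; case: z w => a c [a' c'] /= w0 z0 hw hz.
  apply: (le_trans (ler_norm _)); rewrite -ler_sqr ?nnegrE ?mulr_ge0 //.
  rewrite real_normK ?num_real // exprMn hw hz.
  have := sqr_ge0 (a * c' - c * a'); nra.
rewrite sqrrB !cmod_sqr; move: h; case: z w => a c [a' c'] /=; nra.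
Qed.

End Modulus.

(** * Norm bounds through finite partial sums *)

Section DirichletSpace.
Context {R : realType} {X : countType} (b : graph R X) (o : X).
Implicit Types (f g h : X -> R[i]) (r s : R) (x y : X).

Local Notation Cc := (Defs.finite_support R X).

Definition partial_normsq (F : {fset X * X}) f : R :=
  2^-1 * \sum_(p <- F) b p.1 p.2 * cmod (f p.1 - f p.2) ^+ 2 + cmod (f o) ^+ 2.

(* Says [|f|_o ^ 2 <= r], without having to separate finite from infinite
   energy: every finite partial sum obeys the bound. *)
Definition normsq_le f r := forall F, partial_normsq F f <= r.

Lemma normsq_leP f r :
  normsq_le f r <-> (energy b f + (cmod (f o) ^+ 2)%:E <= r%:E)%E.
Proof.
have t0 p : 0 <= b p.1 p.2 * cmod (f p.1 - f p.2) ^+ 2.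
  by rewrite mulr_ge0 ?weight_ge0 ?sqr_ge0.
rewrite /energy -leeBrDr // -EFinB -lee_pdivlMl ?invr_gt0 // -EFinM invrK.
split=> [h|h F].
  apply: ge_ereal_sup => _ [A [finA _] <-].
  rewrite fsbig_finite //= sumEFin lee_fin.
  by have := h (fset_set A); rewrite /partial_normsq; lra.
have {}h : \sum_(p <- F) b p.1 p.2 * cmod (f p.1 - f p.2) ^+ 2
    <= 2 * (r - cmod (f o) ^+ 2).
  rewrite -lee_fin; apply: le_trans h; apply: esum_ge.
  exists [set` F]; first by split => //; exact: finite_fset.
  by rewrite fsbig_finite //= set_fsetK sumEFin.
by rewrite /partial_normsq; lra.
Qed.

Lemma energy_ge0 f : (0 <= energy b f)%E.
Proof.
apply: mule_ge0; first by rewrite lee_fin invr_ge0.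
by apply: esum_ge0 => p _; rewrite lee_fin mulr_ge0 ?weight_ge0 ?sqr_ge0.
Qed.

Lemma finite_energyP f : finite_energy b f <-> exists r, normsq_le f r.
Proof.
split=> [h|[r /normsq_leP]].
  exists (fine (energy b f) + cmod (f o) ^+ 2); apply/normsq_leP.
  by rewrite EFinD fineK ?ge0_fin_numE // energy_ge0.
by rewrite /finite_energy /=; case: (energy b f) => [a|//|//] _; rewrite ltry.
Qed.

Lemma norm_o_leP f e : 0 <= e ->
  normsq_le f (e ^+ 2) <-> finite_energy b f /\ norm_o b o f <= e.
Proof.
move=> e0; apply: (iff_trans (normsq_leP _ _)).
rewrite /finite_energy /norm_o /=; have := energy_ge0 f.
(* For infinite energy [fine] returns 0 and [norm_o] carries no information; the finiteness conjunct
   refutes the right-hand side. *)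
case: (energy b f) => [a|_|//]; last by split=> [//|[]].
rewrite lee_fin => a0 /=; rewrite -EFinD lee_fin ltry.
have -> : (Num.sqrt (a + cmod (f o) ^+ 2) <= e) =
    (a + cmod (f o) ^+ 2 <= e ^+ 2).
  by rewrite -{1}(ger0_norm e0) -sqrtr_sqr ler_sqrt ?sqr_ge0.
by split=> [|[]].
Qed.

Lemma normsq_le_weaken f r s : r <= s -> normsq_le f r -> normsq_le f s.
Proof. by move=> rs h F; apply: le_trans rs. Qed.

(** Comparing the finite sums term by term suffices; the estimates for sums, products, multiples and
    moduli are all instances. *)
Lemma normsq_le_comb f g h (a c r s : R) : 0 <= a -> 0 <= c ->
  (forall x y, cmod (h x - h y) ^+ 2 <=
     a * cmod (f x - f y) ^+ 2 + c * cmod (g x - g y) ^+ 2) ->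
  cmod (h o) ^+ 2 <= a * cmod (f o) ^+ 2 + c * cmod (g o) ^+ 2 ->
  normsq_le f r -> normsq_le g s -> normsq_le h (a * r + c * s).
Proof.
move=> a0 c0 hxy ho hf hg F.
have := ler_wpM2l a0 (hf F); have := ler_wpM2l c0 (hg F).
suff : \sum_(p <- F) b p.1 p.2 * cmod (h p.1 - h p.2) ^+ 2 <=
    a * \sum_(p <- F) b p.1 p.2 * cmod (f p.1 - f p.2) ^+ 2 +
    c * \sum_(p <- F) b p.1 p.2 * cmod (g p.1 - g p.2) ^+ 2.
  by rewrite /partial_normsq; lra.
rewrite !mulr_sumr -big_split /=; apply: ler_sum => p _.
by have := ler_wpM2l (weight_ge0 b p.1 p.2) (hxy p.1 p.2); lra.
Qed.

Lemma normsq_le_contr f h (a r : R) : 0 <= a ->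
  (forall x y, cmod (h x - h y) ^+ 2 <= a * cmod (f x - f y) ^+ 2) ->
  cmod (h o) ^+ 2 <= a * cmod (f o) ^+ 2 ->
  normsq_le f r -> normsq_le h (a * r).
Proof.
move=> a0 hxy ho hf; rewrite -[a * r]addr0 -(mul0r r).
by apply: (normsq_le_comb (f := f) (g := f)) => // *; rewrite ?mul0r ?addr0.
Qed.

Lemma normsq_leD f g r s : normsq_le f r -> normsq_le g s ->
  normsq_le (fun x => f x + g x) (2 * r + 2 * s).
Proof.
apply: normsq_le_comb => //; last exact: cmod_sqrD.
move=> x y; rewrite (_ : _ + _ - _ = (f x - f y) + (g x - g y)); last by ring.
exact: cmod_sqrD.
Qed.

(** Discrete Leibniz rule: in the increment of [f * g], values of [g] multiply increments of [f] and
    vice versa. *)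
Lemma normsq_leM f g (M N r s : R) :
  (forall x, cmod (f x) ^+ 2 <= M) -> (forall x, cmod (g x) ^+ 2 <= N) ->
  normsq_le f r -> normsq_le g s ->
  normsq_le (fun x => f x * g x) (2 * N * r + 2 * M * s).
Proof.
move=> hM hN hf hg.
have M0 : 0 <= M by apply: le_trans (hM o); rewrite sqr_ge0.
have N0 : 0 <= N by apply: le_trans (hN o); rewrite sqr_ge0.
apply: normsq_le_comb hf hg; rewrite ?mulr_ge0 //; first move=> x y.
  rewrite (_ : _ - _ = (f x - f y) * g x + f y * (g x - g y)); last by ring.
  apply: le_trans (cmod_sqrD _ _) _; rewrite !cmodM !exprMn.
  have := ler_wpM2r (sqr_ge0 (cmod (g x - g y))) (hM y).
  have := ler_wpM2l (sqr_ge0 (cmod (f x - f y))) (hN x); lra.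
rewrite cmodM exprMn; have := ler_wpM2l (sqr_ge0 (cmod (f o))) (hN o).
have := mulr_ge0 M0 (sqr_ge0 (cmod (g o))).
have := mulr_ge0 N0 (sqr_ge0 (cmod (f o))); lra.
Qed.

(* Lower semicontinuity of the norm; it replaces completeness of [D]. *)
Lemma normsq_le_lim (u : nat -> X -> R[i]) f r :
  (forall x y,
     (fun n => cmod (u n x - u n y)) @ \oo --> cmod (f x - f y)) ->
  (fun n => cmod (u n o)) @ \oo --> cmod (f o) ->
  (\forall n \near \oo, normsq_le (u n) r) -> normsq_le f r.
Proof.
move=> uxy uo ur F.
have cvg_sqr (v : nat -> R) (l : R) :
    v @ \oo --> l -> v n ^+ 2 @[n --> \oo] --> l ^+ 2.
  by move=> vl; under eq_fun do rewrite expr2; rewrite expr2; exact: cvgM.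
have cv : partial_normsq F (u n) @[n --> \oo] --> partial_normsq F f.
  apply: cvgD; last exact: cvg_sqr.
  apply: cvgMl_tmp; apply: cvg_big => [|p _]; first exact: add_continuous.
  by apply: cvgMl_tmp; exact: cvg_sqr.
by apply: (cvgr_to_le cv); apply: filterS ur.
Qed.

Lemma normsq_leN f r : normsq_le f r -> normsq_le (fun x => - f x) r.
Proof.
move=> hf; rewrite -(mul1r r); apply: normsq_le_contr hf => // [x y|].
  by rewrite mul1r -opprD cmodN.
by rewrite mul1r cmodN.
Qed.

Lemma normsq_leB f g r s : normsq_le f r -> normsq_le g s ->
  normsq_le (fun x => f x - g x) (2 * r + 2 * s).
Proof. by move=> hf /normsq_leN; exact: normsq_leD. Qed.

Lemma normsq_leZ f r (c : R) : normsq_le f r ->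
  normsq_le (fun x => c%:C%C * f x) (c ^+ 2 * r).
Proof.
apply: normsq_le_contr => [|x y|]; first exact: sqr_ge0.
  by rewrite -mulrBr cmodM exprMn cmod_real real_normK ?num_real.
by rewrite cmodM exprMn cmod_real real_normK ?num_real.
Qed.

(** Serves to make the terms of a series nonnegative, so that they cannot cancel. *)
Lemma normsq_le_cmod f r : normsq_le f r ->
  normsq_le (fun x => (cmod (f x))%:C%C) r.
Proof.
move=> hf; rewrite -(mul1r r); apply: normsq_le_contr hf => // [x y|].
  by rewrite mul1r -rmorphB cmod_real real_normK ?num_real // cmod_dist.
by rewrite mul1r cmod_real ger0_norm ?cmod_ge0.
Qed.

Lemma normsq_le0 r : 0 <= r -> normsq_le (fun _ : X => 0) r.
Proof.
move=> r0 F; rewrite /partial_normsq cmod0 expr0n addr0.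
by rewrite big1 ?mulr0 // => p _; rewrite subrr cmod0 expr0n mulr0.
Qed.

(** * Bounds at single nodes and along paths *)

Lemma normsq_le_base f r : normsq_le f r -> cmod (f o) ^+ 2 <= r.
Proof.
by move=> /(_ fset0); rewrite /partial_normsq big_seq_fset0 mulr0 add0r.
Qed.

Lemma normsq_le_ge0 f r : normsq_le f r -> 0 <= r.
Proof. by move/normsq_le_base; apply: le_trans; exact: sqr_ge0. Qed.

Lemma normsq_le_edge f r x y : normsq_le f r ->
  b x y * cmod (f x - f y) ^+ 2 <= 2 * r.
Proof.
move=> /(_ [fset (x, y)]%fset); rewrite /partial_normsq big_seq_fset1 /=.
by have := sqr_ge0 (cmod (f o)); lra.
Qed.

Lemma path_diff_bound (p : seq X) x : path (fun u v => 0 < b u v) x p ->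
  exists2 K : R, 0 <= K & forall f r, normsq_le f r ->
    cmod (f x - f (last x p)) ^+ 2 <= K * r.
Proof.
elim: p x => [|y p IH] x /=.
  move=> _; exists 0 => // f r _.
  by rewrite subrr cmod0 expr0n mul0r.
move=> /andP[bxy /IH[K K0 hK]].
(* The edge costs at most [2 / b x y] and the remaining path [K]; [cmod_sqrD] doubles both. *)
exists (4 / b x y + 2 * K) => [|f r hf].
  by rewrite addr_ge0 ?mulr_ge0 ?invr_ge0 // ltW.
have := hK _ _ hf; have := normsq_le_edge x y hf.
rewrite -ler_pdivlMl // => h1 h2.
rewrite (_ : f x - _ = (f x - f y) + (f y - f (last y p))); last by ring.
apply: le_trans (cmod_sqrD _ _) _.
rewrite (_ : (_ + _) * r = 2 * ((b x y)^-1 * (2 * r)) + 2 * (K * r)).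
  by lra.
by ring.
Qed.

(** Follow a path from [x] to [o]. The constant depends on [x]; whether it can be chosen uniformly
    is what separates the two cases of the theorem. *)
Lemma point_evaluation_bound x : connected_graph b ->
  exists2 K : R, 0 <= K & forall f r, normsq_le f r -> cmod (f x) ^+ 2 <= K * r.
Proof.
move=> /(_ x o)[p [/path_diff_bound[K K0 hK] lp]].
exists (2 * K + 2) => [|f r hf]; first by rewrite addr_ge0 ?mulr_ge0.
have := hK _ _ hf; have := normsq_le_base hf; rewrite lp => h1 h2.
rewrite -[f x](subrK (f o)); apply: le_trans (cmod_sqrD _ _) _; lra.
Qed.

(** * Finitely supported functions and their energy *)

Lemma finite_support0 : Cc (fun=> 0).
Proof.
rewrite /Defs.finite_support /= (_ : [set x | _] = set0) //.
by apply/seteqP; split => // x /=; rewrite eqxx.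
Qed.

Lemma finite_supportD f g : Cc f -> Cc g ->
  Cc (fun x => f x + g x).
Proof.
rewrite /Defs.finite_support /= => hf hg.
have hfg : finite_set ([set x | f x != 0] `|` [set x | g x != 0]).
  by rewrite finite_setU.
apply: sub_finite_set hfg => x /= h.
have [fx0|] := eqVneq (f x) 0; last by left.
by right; move: h; rewrite fx0 add0r.
Qed.

Lemma weight_sum_bound x : exists2 D : R, 0 <= D & forall s : seq X, uniq s ->
  \sum_(y <- s) b x y <= D.
Proof.
have h := weight_summable b x.
have h0 : (0 <= \esum_(y in [set: X]) (b x y)%:E)%E.
  by apply: esum_ge0 => y _; rewrite lee_fin weight_ge0.
exists (fine (\esum_(y in [set: X]) (b x y)%:E)); first exact: fine_ge0.
move=> s us; rewrite -lee_fin fineK ?ge0_fin_numE //.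
apply: esum_ge; exists [set` s]; first by split => //; exact: finite_seq.
by rewrite -fsbig_seq // sumEFin.
Qed.

(** Only pairs with a coordinate [z] contribute, and their weights sum to at most twice the total
    weight at [z]. *)
Lemma normsq_le_delta z (c : R[i]) :
  exists r, normsq_le (fun x => if x == z then c else 0) r.
Proof.
have [D D0 hD] := weight_sum_bound z.
(* Among pairs with one coordinate fixed at [z], the other coordinates are distinct, so the
   summability bound applies. *)
have star (u v : X * X -> X) (F : {fset X * X}) :
    injective (fun p => (u p, v p)) -> \sum_(p <- F | u p == z) b z (v p) <= D.
  move=> inj; rewrite -big_filter -(big_map v xpredT); apply: hD.
  rewrite map_inj_in_uniq ?filter_uniq ?fset_uniq // => p q.
  rewrite !mem_filter => /andP[/eqP up _] /andP[/eqP uq _] vpq.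
  by apply: inj; rewrite up uq vpq.
pose f x := if x == z then c else 0.
exists (2^-1 * (2 * cmod c ^+ 2 * (D + D)) + cmod c ^+ 2) => F.
have c0 : cmod (0 : R[i]) ^+ 2 = 0 by rewrite cmod0 expr0n.
have fE x : cmod (f x) ^+ 2 = cmod c ^+ 2 * (x == z)%:R.
  by rewrite /f; case: eqP; rewrite ?c0 ?mulr1 ?mulr0.
rewrite lerD //; last first.
  by rewrite fE; case: (_ == _); rewrite ?mulr1 ?mulr0 ?sqr_ge0.
rewrite ler_wpM2l ?invr_ge0 //.
apply: (@le_trans _ _ (2 * cmod c ^+ 2 *
    (\sum_(p <- F | p.1 == z) b z p.2 + \sum_(p <- F | p.2 == z) b z p.1))).
  rewrite !(big_mkcond (fun p : X * X => _ == z)) -big_split mulr_sumr /=.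
  apply: ler_sum => p _.
  apply: (@le_trans _ _ (b p.1 p.2 *
      (2 * (cmod c ^+ 2 * (p.1 == z)%:R) + 2 * (cmod c ^+ 2 * (p.2 == z)%:R)))).
    rewrite ler_wpM2l ?weight_ge0 // -!fE; apply: le_trans (cmod_sqrD _ _) _.
    by rewrite cmodN.
  case: eqP => [->|_]; case: eqP => [->|_];
    rewrite ?weight_diag ?(weight_sym b z) ?mulr1 ?mulr0 /=; lra.
apply: ler_wpM2l; first by rewrite mulr_ge0 ?sqr_ge0.
apply: lerD; apply: star.
  by move=> [? ?] [? ?] [-> ->].
by move=> [? ?] [? ?] [-> ->].
Qed.

Lemma finite_support_normsq f : Cc f -> exists r, normsq_le f r.
Proof.
move=> /finite_seqP[s fs].
have {fs} : forall x, f x != 0 -> x \in s.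
  by move=> x fx; have : [set x | f x != 0] x by []; rewrite fs.
elim: s f => [|z s IH] f hs.
  exists 0; rewrite (_ : f = fun=> 0); first exact: normsq_le0.
  by apply/funext => x; apply/eqP/negPn/negP => /hs.
have [c hc] := normsq_le_delta z (f z).
(* Split off the value at [z]; what remains is supported in [s]. *)
have [|r hr] := IH (fun x => if x == z then 0 else f x).
  move=> x; case: (eqVneq x z) => [_|xz fx]; first by rewrite eqxx.
  by have := hs _ fx; rewrite inE (negPf xz).
exists (2 * r + 2 * c); have := normsq_leD hr hc.
congr normsq_le; apply/funext => x.
by case: eqP => [->|_]; rewrite ?add0r ?addr0.
Qed.

(** * Approximation and series in [D0] *)

Lemma D0P f : D0 b o f <-> (exists r, normsq_le f r) /\
  forall e : R, 0 < e ->
    exists2 g, Cc g & normsq_le (fun x => f x - g x) e.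
Proof.
split=> [[/finite_energyP[r hr] h]|[/finite_energyP hf h]].
  split; first by exists r.
  move=> e e0; have se0 : 0 < Num.sqrt e by rewrite sqrtr_gt0.
  have [g [gs gn]] := h _ se0; exists g => //.
  (* A bound on [norm_o] is meaningful only once [f - g] is known to have finite energy. *)
  have [s hs] := finite_support_normsq gs.
  rewrite -(sqr_sqrtr (ltW e0)); apply/norm_o_leP; rewrite ?sqrtr_ge0 //.
  split; last exact: ltW.
  by apply/finite_energyP; eexists; apply: normsq_leB hr hs.
(* [normsq_le] gives a weak inequality; halving [e] restores the strict one. *)
split=> // e e0; have e20 : 0 < (e / 2) ^+ 2 by rewrite exprn_gt0 ?divr_gt0.
have [g gs gn] := h _ e20; exists g; split => //.
have /norm_o_leP[] := gn; first by rewrite ltW ?divr_gt0.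
by move=> _ /le_lt_trans; apply; lra.
Qed.

Lemma normsq_le_tail (psi : nat -> X -> R) :
  (forall k, normsq_le (fun x => (psi k x)%:C%C) (8^-1 ^+ k)) ->
  forall j n, normsq_le (fun x => (\sum_(n <= k < n + j) psi k x)%:C%C)
    (4 * 8^-1 ^+ n).
Proof.
move=> hpsi; elim=> [|j IH] n.
  have e0 : 0 <= 4 * 8^-1 ^+ n :> R by rewrite mulr_ge0 ?exprn_ge0 ?invr_ge0.
  have := normsq_le0 e0; congr normsq_le; apply/funext => x.
  by rewrite addn0 big_geq.
have := normsq_leD (hpsi n) (IH n.+1).
rewrite (_ : (fun x => _) =
    (fun x => (\sum_(n <= k < n + j.+1) psi k x)%:C%C)); last first.
  apply/funext => x; rewrite addnS -addSn [in RHS]big_ltn ?rmorphD //.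
  by rewrite addSn ltnS leq_addr.
(* Splitting off the first term doubles both bounds: [2 * 8^-n + 2 * 4 * 8^-(n+1) = 3 * 8^-n], below
   [4 * 8^-n]. *)
apply: normsq_le_weaken; rewrite exprS.
have : 0 <= 8^-1 ^+ n :> R by rewrite exprn_ge0 ?invr_ge0.
by set t := 8^-1 ^+ n; lra.
Qed.

(** Point evaluation bounds the monotone partial sums at each node, so they converge pointwise;
    lower semicontinuity carries the tail bounds over to the limit. *)
Lemma D0_series (psi : nat -> X -> R) : connected_graph b ->
  (forall k x, 0 <= psi k x) -> (forall k, Cc (fun x => (psi k x)%:C%C)) ->
  (forall k, normsq_le (fun x => (psi k x)%:C%C) (8^-1 ^+ k)) ->
  exists2 F : X -> R, (forall k x, psi k x <= F x) &
    D0 b o (fun x => (F x)%:C%C).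
Proof.
move=> conn psi0 psis /normsq_le_tail tail.
pose S n x : R := \sum_(0 <= k < n) psi k x.
have ndS x : nondecreasing_seq (S^~ x).
  by apply/nondecreasing_seqP => n; rewrite /S big_nat_recr //= lerDl.
have cvgS x : S n x @[n --> \oo] --> limn (S^~ x).
  apply: nondecreasing_is_cvgn => //.
  have [K K0 hK] := point_evaluation_bound x conn.
  (* From [S ^+ 2 <= 4 * K] and [2 * S <= S ^+ 2 + 1], avoiding a square root. *)
  exists (1 + K * 4) => _ [n _ <-].
  have := hK _ _ (tail n 0%N).
  rewrite cmod_real real_normK ?num_real // add0n expr0 mulr1 -/(S n x) => h.
  by have := sqr_ge0 (S n x - 1); nra.
pose F x := limn (S^~ x).
have SF n x : S n x <= F x.
  by apply: nondecreasing_cvgn_le => //; exact: cvgP (cvgS x).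
have tailF n : normsq_le (fun x => (F x)%:C%C - (S n x)%:C%C) (4 * 8^-1 ^+ n).
  apply: (@normsq_le_lim (fun m x => (S m x)%:C%C - (S n x)%:C%C)).
  - move=> x y; rewrite -!rmorphB cmod_real.
    under eq_fun do rewrite -!rmorphB cmod_real.
    by apply: cvg_norm; apply: cvgB; apply: cvgB => //; apply: cvg_cst.
  - rewrite -!rmorphB cmod_real; under eq_fun do rewrite -!rmorphB cmod_real.
    by apply: cvg_norm; apply: cvgB => //; apply: cvg_cst.
  exists n => // m /= nm; have := tail (m - n)%N n; rewrite subnKC //.
  congr normsq_le; apply/funext => x.
  have -> : S m x = S n x + \sum_(n <= k < m) psi k x.
    by rewrite /S -big_cat_nat.
  by rewrite rmorphD addrC addKr.
have Ss n : Cc (fun x => (S n x)%:C%C).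
  elim: n => [|n IH].
    rewrite (_ : (fun x => _) = fun=> 0); first exact: finite_support0.
    by apply/funext => x; rewrite /S big_geq.
  have := finite_supportD IH (psis n); congr Cc; apply/funext => x.
  by rewrite -rmorphD /S big_nat_recr.
exists F => [k x|].
  apply: le_trans (SF k.+1 x); rewrite /S big_nat_recr //= lerDr.
  by apply: sumr_ge0.
apply/D0P; split.
  exists 4; have := tailF 0%N; rewrite expr0 mulr1.
  congr normsq_le; apply/funext => x; by rewrite /S big_geq // subr0.
(* This gives [4 / e < n <= 8 ^ n], hence [4 * 8^-n <= e]. *)
move=> e e0; pose n := Num.bound (4 / e).
exists (fun x => (S n x)%:C%C) => //; apply: normsq_le_weaken (tailF n).
rewrite exprVn ler_pdivrMr ?exprn_gt0 // mulrC -ler_pdivrMr //.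
have : 4 / e < n%:R by apply: archi_boundP; rewrite divr_ge0 // ltW.
move=> /ltW /le_trans; apply; rewrite -natrX ler_nat.
by apply: ltnW; exact: ltn_expl.
Qed.

(** * Optimal evaluation constants and an unbounded element of [D0] *)

Lemma D0_point_le x (C : R) : connected_graph b -> 0 <= C ->
  (forall f r, Cc f -> normsq_le f r -> cmod (f x) ^+ 2 <= C * r) ->
  forall f r, D0 b o f -> normsq_le f r -> cmod (f x) ^+ 2 <= 4 * C * r.
Proof.
move=> conn C0 hC f r /D0P[_ hf] hr.
have [K K0 hK] := point_evaluation_bound x conn.
apply/ler_addgt0Pr => e e0.
(* An approximant with squared error [d] yields [2 * K * d + 2 * C * (2 * r + 2 * d)]. The
   node-dependent [K] multiplies only [d], so it disappears in the limit and [4 * C * r] is left. *)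
have A0 : 0 < 2 * K + 4 * C + 1 by rewrite ltr_wpDl ?addr_ge0 ?mulr_ge0.
have d0 : 0 < e / (2 * K + 4 * C + 1) by rewrite divr_gt0.
have [g gs hg] := hf _ d0.
have hg' : normsq_le g (2 * r + 2 * (e / (2 * K + 4 * C + 1))).
  have := normsq_leB hr hg; congr normsq_le.
  by apply/funext => y; rewrite opprB addrC subrK.
have := hC _ _ gs hg'; have := hK _ _ hg.
have de : e / (2 * K + 4 * C + 1) * (2 * K + 4 * C + 1) = e.
  by rewrite mulfVK ?gt_eqF.
move: d0 de; set d := e / _ => d0 de h1 h2.
rewrite -[f x](subrK (g x)); apply: le_trans (cmod_sqrD _ _) _; nra.
Qed.

Lemma extremal_point x (M : R) f r : connected_graph b -> 0 <= M ->
  Cc f -> normsq_le f r -> M * r < cmod (f x) ^+ 2 ->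
  exists K g, [/\ M < K, Cc g, normsq_le g 1, K <= 2 * cmod (g x) ^+ 2 &
    forall h s, Cc h -> normsq_le h s -> cmod (h x) ^+ 2 <= K * s].
Proof.
move=> conn M0 fs hr hf.
have [B B0 hB] := point_evaluation_bound x conn.
(* [sup E] is the optimal constant at [x]: the supremum over the unit ball of the finitely supported
   functions, extended to all of them by scaling. *)
pose E := [set cmod (g x) ^+ 2 | g in [set g | Cc g /\ normsq_le g 1]].
have supE : has_sup E.
  split; last by exists B => _ [g [_ /hB]] + <-; rewrite mulr1.
  exists (cmod (0 : R[i]) ^+ 2), (fun=> 0) => //.
  by split; [exact: finite_support0|exact: normsq_le0].
have hK h s : Cc h -> normsq_le h s -> cmod (h x) ^+ 2 <= sup E * s.
  (* A function with [s = 0] cannot be normalised; it vanishes at [x] by [hB]. *)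
  move=> hs hn; have := normsq_le_ge0 hn; rewrite le_eqVlt => /predU1P[s0|s0].
    by have := hB _ _ hn; rewrite -s0 !mulr0.
  rewrite -ler_pdivrMr // mulrC; apply: sup_upper_bound => //.
  have cs : (Num.sqrt s)^-1 ^+ 2 = s^-1 by rewrite exprVn sqr_sqrtr // ltW.
  exists (fun y => ((Num.sqrt s)^-1)%:C%C * h y).
    split; last first.
      by have := normsq_leZ (Num.sqrt s)^-1 hn; rewrite cs mulVf // gt_eqF.
    move: hs; rewrite /Defs.finite_support /=; apply: sub_finite_set => y /=.
    by apply: contraNN => /eqP ->; rewrite mulr0.
  by rewrite cmodM exprMn cmod_real real_normK ?num_real // cs.
have MK : M < sup E.
  have := lt_le_trans hf (hK _ _ fs hr); have := normsq_le_ge0 hr.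
  by rewrite le_eqVlt => /predU1P[<-|r0]; rewrite ?mulr0 ?ltxx // ltr_pM2r.
have K20 : 0 < sup E / 2 by rewrite divr_gt0 // (le_lt_trans M0).
have [_ [g [gs gn] <-] hg] := sup_adherent K20 supE.
by exists (sup E), g; split => //; lra.
Qed.

(* The threshold [k.+1 / q k ^ 4] makes both
   [k.+1 < q_k^4 K_k <= q_k^2 K_k <= 2 F(x_k)^2] and
   [q_k^4 K_k^2 <= 4 F(x_k)^4 <= 16 K_k |F^2|_o^2] available. *)
Lemma D0_unbounded : connected_graph b ->
  ~ (exists2 C : R, 0 <= C & forall x f r, Cc f -> normsq_le f r ->
       cmod (f x) ^+ 2 <= C * r) ->
  exists F : X -> R,
    [/\ D0 b o (fun x => (F x)%:C%C), forall M, exists x, M < F x ^+ 2 &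
      ~ D0 b o (fun x => (F x)%:C%C * (F x)%:C%C)].
Proof.
(* The squares [q k ^+ 2 = 16^-k] lie below the [8^-k] that [D0_series] asks for. *)
move=> conn nobound; pose q k : R := 4^-1 ^+ k.
have q0 k : 0 < q k by rewrite exprn_gt0 ?invr_gt0.
have q1 k : q k ^+ 2 <= 1.
  by rewrite -exprM exprn_ile1 ?invr_ge0 ?invf_le1 ?ler1n.
have ext (k : nat) : exists t : X * R * (X -> R[i]),
    [/\ k.+1%:R / q k ^+ 4 < t.1.2, Cc t.2, normsq_le t.2 1,
        t.1.2 <= 2 * cmod (t.2 t.1.1) ^+ 2 &
    forall h s, Cc h -> normsq_le h s -> cmod (h t.1.1) ^+ 2 <= t.1.2 * s].
  have M0 : 0 <= k.+1%:R / q k ^+ 4 by rewrite divr_ge0 ?exprn_ge0 // ltW.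
  (* If no node exceeded the threshold, the threshold itself would be a uniform bound. *)
  apply: contrapT => noext; apply: nobound; exists (k.+1%:R / q k ^+ 4) => //.
  move=> x f r fs hr; rewrite leNgt; apply/negP => lt_f.
  have [K [g hKg]] := extremal_point conn M0 fs hr lt_f.
  by apply: noext; exists (x, K, g).
have [t ht] := choice ext.
pose x k := (t k).1.1; pose K k := (t k).1.2; pose phi k := (t k).2.
have K0 k : 0 < K k.
  have [h _ _ _ _] := ht k; apply: le_lt_trans h.
  by rewrite divr_ge0 ?exprn_ge0 // ltW.
pose psi k y : R := q k * cmod (phi k y).
have psi0 k y : 0 <= psi k y by rewrite mulr_ge0 ?cmod_ge0 // ltW.
have psis k : Cc (fun y => (psi k y)%:C%C).
  have [_ + _ _ _] := ht k; rewrite /Defs.finite_support /=.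
  apply: sub_finite_set => y /=; apply: contraNN => /eqP phi0.
  by rewrite /psi /phi phi0 cmod0 mulr0.
have psin k : normsq_le (fun y => (psi k y)%:C%C) (8^-1 ^+ k).
  have [_ _ hn _ _] := ht k.
  have := normsq_leZ (q k) (normsq_le_cmod hn).
  rewrite (_ : (fun y => _) = fun y => (psi k y)%:C%C); last first.
    by apply/funext => y; rewrite -rmorphM.
  apply: normsq_le_weaken; rewrite mulr1 -exprM mulnC exprM.
  by rewrite lerXn2r ?nnegrE ?exprn_ge0 ?invr_ge0 //; lra.
have [F psiF DF] := D0_series conn psi0 psis psin.
have FK k : K k * q k ^+ 2 <= 2 * F (x k) ^+ 2.
  have [_ _ _ hx _] := ht k.
  have : psi k (x k) ^+ 2 <= F (x k) ^+ 2.
    have pF := psiF k (x k).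
    by rewrite lerXn2r ?nnegrE // (le_trans (psi0 k (x k))).
  rewrite /psi exprMn => h; have := ler_wpM2l (sqr_ge0 (q k)) hx.
  by rewrite -/(K k) -/(x k) -/(phi k) => h'; lra.
have Kbig k : k.+1%:R < K k * q k ^+ 4.
  by have [h _ _ _ _] := ht k; rewrite -ltr_pdivrMr ?exprn_gt0.
have bigE (M : R) : exists k : nat, M < k.+1%:R.
  exists (Num.bound `|M|); apply: le_lt_trans (ler_norm _) _.
  by apply: lt_trans (archi_boundP (normr_ge0 M)) _; rewrite ltr_nat.
exists F; split => // [M|DF2].
  have [k Mk] := bigE (2 * M); exists (x k).
  have := FK k; have := lt_trans Mk (Kbig k).
  have := ler_wpM2l (mulr_ge0 (ltW (K0 k)) (sqr_ge0 (q k))) (q1 k).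
  by rewrite mulr1 -mulrA -exprD; lra.
have /D0P[[r hr] _] := DF2; have [k rk] := bigE (16 * r).
have [_ _ _ _ hK] := ht k.
have := D0_point_le conn (ltW (K0 k)) hK DF2 hr.
rewrite -/(x k) -rmorphM cmod_real real_normK ?num_real // => F4.
have F2 : (K k * q k ^+ 2) ^+ 2 <= (2 * F (x k) ^+ 2) ^+ 2.
  have FKk := FK k; have Kq0 : 0 <= K k * q k ^+ 2.
    by rewrite mulr_ge0 ?sqr_ge0 // ltW.
  by rewrite lerXn2r ?nnegrE // (le_trans Kq0).
have : K k * (16 * r) < K k * (K k * q k ^+ 4).
  by rewrite ltr_pM2l //; exact: lt_trans rk (Kbig k).
apply/negP; rewrite -leNgt; move: F2 F4; lra.
Qed.

(** * Consequences of a uniform evaluation bound *)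

Lemma uniformly_bounded_D0 (C : R) : connected_graph b -> 0 <= C ->
  (forall x f r, Cc f -> normsq_le f r -> cmod (f x) ^+ 2 <= C * r) ->
  forall f r, D0 b o f -> normsq_le f r ->
  forall x, cmod (f x) ^+ 2 <= 4 * C * r.
Proof.
move=> conn C0 hC f r Df hr x.
by apply: D0_point_le Df hr => // g s; exact: hC.
Qed.

Lemma Cc_D0 g : Cc g -> D0 b o g.
Proof.
move=> gs; apply/D0P; split; first exact: finite_support_normsq.
move=> e e0; exists g => //.
rewrite (_ : (fun x => _) = fun=> 0); first exact: normsq_le0 (ltW e0).
by apply/funext => x; rewrite subrr.
Qed.

Lemma D0B f g : D0 b o f -> Cc g -> D0 b o (fun x => f x - g x).
Proof.
move=> /D0P[[r hr] h] gs; have [s hs] := finite_support_normsq gs.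
apply/D0P; split; first by eexists; apply: normsq_leB hr hs.
move=> e /h[k ks hk]; exists (fun x => k x + -1 * g x).
  apply: finite_supportD => //; move: gs; rewrite /Defs.finite_support /=.
  apply: sub_finite_set => x /=; apply: contraNN => /eqP ->.
  by rewrite mulr0.
by move: hk; congr normsq_le; apply/funext => x; ring.
Qed.

Lemma bounded_evaluation_transient (C : R) : connected_graph b -> 0 <= C ->
  (forall x f r, Cc f -> normsq_le f r -> cmod (f x) ^+ 2 <= C * r) ->
  uniformly_transient b o.
Proof.
move=> conn C0 /(uniformly_bounded_D0 conn C0) hC f Df.
have /D0P[[r hr] h] := Df; split.
  exists (1 + 4 * C * r) => x; have := hC _ _ Df hr x.
  by have := sqr_ge0 (cmod (f x) - 1); nra.
move=> e e0; have C40 : 0 < 4 * C + 1 by rewrite ltr_wpDl ?mulr_ge0.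
(* This squared error makes [4 * C * d] at most [(e / 2) ^+ 2]; the half keeps the supremum strictly
   below [e]. *)
have d0 : 0 < (e / 2) ^+ 2 / (4 * C + 1).
  by rewrite divr_gt0 ?exprn_gt0 ?divr_gt0.
have [g gs hg] := h _ d0; exists g; split => //.
apply: (@le_lt_trans _ _ (e / 2)); last by lra.
apply: ge_sup; first by exists (cmod (f o - g o)), o.
move=> _ [x _ <-]; rewrite -ler_sqr ?nnegrE ?cmod_ge0 ?divr_ge0 // ?(ltW e0) //.
apply: le_trans (hC _ _ (D0B Df gs) hg x) _.
rewrite mulrA ler_pdivrMr // mulrC ler_wpM2l ?sqr_ge0 //; lra.
Qed.

Lemma bounded_evaluation_algebra (C : R) : connected_graph b -> 0 <= C ->
  (forall x f r, Cc f -> normsq_le f r -> cmod (f x) ^+ 2 <= C * r) ->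
  is_algebra (D0 b o).
Proof.
move=> conn C0 /(uniformly_bounded_D0 conn C0) hC f g Df Dg.
(* [normsq_leM] with the sup bounds [4 * C * r] and [4 * C * s] gives [16 * C * r * s]. *)
have mul h k r s : D0 b o h -> D0 b o k -> normsq_le h r -> normsq_le k s ->
    normsq_le (fun x => h x * k x) (16 * C * r * s).
  move=> Dh Dk hr ks.
  have := normsq_leM (hC _ _ Dh hr) (hC _ _ Dk ks) hr ks.
  by apply: normsq_le_weaken; lra.
have /D0P[[r hr] hf] := Df; have /D0P[[s hs] hg] := Dg.
apply/D0P; split; first by eexists; exact: mul hr hs.
move=> e e0.
(* Two error terms of at most [e / 4] each, doubled by [normsq_leD], add up to [e]. *)
have small (c : R) : 0 <= c -> exists2 d, 0 < d & c * d <= e / 4.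
  move=> c0; exists (e / 4 / (c + 1)); first by rewrite !divr_gt0 // ltr_wpDl.
  rewrite mulrCA ler_piMr ?divr_ge0 ?(ltW e0) //.
  by rewrite ler_pdivrMr ?ltr_wpDl // mul1r lerDl.
have [|d d0 hd] := small (16 * C * s).
  by rewrite !mulr_ge0 // (normsq_le_ge0 hs).
have [phi phis hphi] := hf _ d0.
have [t ht] := finite_support_normsq phis.
(* The second tolerance depends on the norm of [phi], so it is chosen after [phi]. *)
have [|d' d'0 hd'] := small (16 * C * t).
  by rewrite !mulr_ge0 // (normsq_le_ge0 ht).
have [gam gams hgam] := hg _ d'0.
exists (fun x => phi x * gam x).
  move: phis; rewrite /Defs.finite_support /=; apply: sub_finite_set => x /=.
  by apply: contraNN => /eqP ->; rewrite mul0r.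
(* The error splits as [f * g - phi * gam = (f - phi) * g + phi * (g - gam)]. *)
have h1 := mul _ _ _ _ (D0B Df phis) Dg hphi hs.
have h2 := mul _ _ _ _ (Cc_D0 phis) (D0B Dg gams) ht hgam.
have := normsq_leD h1 h2.
rewrite (_ : (fun x => _) = fun x => f x * g x - phi x * gam x); last first.
  by apply/funext => x; ring.
by apply: normsq_le_weaken; lra.
Qed.

End DirichletSpace.

Theorem theorem3 (R : realType) (X : countType) (b : graph R X) (o : X)
    (conn : connected_graph b) :
  uniformly_transient b o <-> is_algebra (D0 b o).
Proof.
set bounded := exists2 C : R, 0 <= C & forall x f r,
  Defs.finite_support R X f -> normsq_le b o f r -> cmod (f x) ^+ 2 <= C * r.
(* With a uniform bound both properties hold; without one, the same [F] refutes both. *)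
have [[C C0 hC]|nobound] := pselect bounded.
  split=> _; first exact: bounded_evaluation_algebra hC.
  exact: bounded_evaluation_transient hC.
have [F [DF Finf DF2]] := D0_unbounded conn nobound.
split=> [/(_ _ DF)[[M FM] _]|alg]; last by case: DF2; exact: alg.
have [x] := Finf (M ^+ 2); rewrite ltNge => /negP[].
have := FM x; rewrite cmod_real => h.
rewrite -[_ ^+ 2]real_normK ?num_real //.
by rewrite lerXn2r ?nnegrE ?(le_trans _ h).
Qed.
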